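(* Let $E$ be a complex normed space, and take $m\in\mathbb N$. Then the normed spaces $(E^m,\|\cdot\|_m^{\max})$ and $(\ell_m^\infty\otimes E,\|\cdot\|_\pi)$ are isometrically isomorphic.
   Context: $\ell_m^\infty$ is $\mathbb C^m$ with the maximum norm. $\|\cdot\|_\pi$ is the projective norm on the algebraic tensor product: $\|z\|_\pi=\inf\{\sum_i\|u_i\|\|x_i\|:z=\sum_iu_i\otimes x_i\}$ (infimum over all finite representations). A multi-norm based on a complex normed space $(E,\|\cdot\|)$ is a sequence $(\|\cdot\|_k:k\in\mathbb N)$, with $\|\cdot\|_k$ a norm on $E^k$ and $\|x\|_1=\|x\|$, such that for each $k\ge2$: (A1) $\|(x_{\sigma(1)},\dots,x_{\sigma(k)})\|_k=\|(x_1,\dots,x_k)\|_k$ for each permutation $\sigma$ of $\{1,\dots,k\}$; (A2) $\|(\alpha_1x_1,\dots,\alpha_kx_k)\|_k\le(\max_i|\alpha_i|)\|(x_1,\dots,x_k)\|_k$ for $\alpha_i\in\mathbb C$; (A3) $\|(x_1,\dots,x_{k-1},0)\|_k=\|(x_1,\dots,x_{k-1})\|_{k-1}$; (A4) $\|(x_1,\dots,x_{k-2},x_{k-1},x_{k-1})\|_k=\|(x_1,\dots,x_{k-1})\|_{k-1}$, for all $x_i\in E$. The maximum multi-norm $(\|\cdot\|_n^{\max}:n\in\mathbb N)$ based on $E$ is the pointwise supremum of all multi-norms based on $E$ (it is itself a multi-norm). *)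

(* Defs.v *)
From HB Require Import structures.
From mathcomp Require Import all_boot all_order all_algebra.
From mathcomp Require Import all_classical all_reals all_analysis.
From mathcomp Require Import perm complex.

Set Implicit Arguments.
Unset Strict Implicit.
Unset Printing Implicit Defensive.

Import Order.TTheory GRing.Theory Num.Theory.
Import numFieldNormedType.Exports.

Local Open Scope classical_set_scope.
Local Open Scope ring_scope.
Local Open Scope complex_scope.
Local Open Scope quotient_scope.

(* A list [:: (u1, v1); ...; (un, vn)] stands for the formal sum of the
  u_i ⊗ v_i.  The tensor product is the quotient of formal sums by the least
  congruence making concatenation commutative and ⊗ bilinear.  No scalars are
  attached to the terms, since a (u ⊗ v) is the term (a u) ⊗ v; for the same
  reason the empty sum has to be identified with 0 ⊗ v explicitly. *)

Section Tensor.
Variables (K : comNzRingType) (U V : lmodType K).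

Inductive tens_congr : seq (U * V) -> seq (U * V) -> Prop :=
| tens_congr_refl s : tens_congr s s
| tens_congr_sym s t : tens_congr s t -> tens_congr t s
| tens_congr_trans s t r : tens_congr s t -> tens_congr t r -> tens_congr s r
| tens_congr_cat s s' t t' :
    tens_congr s s' -> tens_congr t t' -> tens_congr (s ++ t) (s' ++ t')
| tens_congr_catC s t : tens_congr (s ++ t) (t ++ s)
| tens_congr_zero v : tens_congr [:: (0, v)] [::]
| tens_congr_addl u u' v :
    tens_congr [:: (u + u', v)] [:: (u, v); (u', v)]
| tens_congr_addr u v v' :
    tens_congr [:: (u, v + v')] [:: (u, v); (u, v')]
| tens_congr_scale a u v : tens_congr [:: (a *: u, v)] [:: (u, a *: v)].

Definition tens_rel (s t : seq (U * V)) : bool := `[< tens_congr s t >].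

Fact tens_rel_equiv : equiv_class_of tens_rel.
Proof.
split.
- by move=> s; apply/asboolP/tens_congr_refl.
- by move=> s t; apply/asboolP/asboolP; apply: tens_congr_sym.
- by move=> t s r /asboolP st /asboolP tr; apply/asboolP/(tens_congr_trans st).
Qed.

Canonical tens_equiv := EquivRelPack tens_rel_equiv.

Definition tens := {eq_quot tens_equiv}.

HB.instance Definition _ := Choice.on tens.
HB.instance Definition _ := EqQuotient.on tens.

Lemma tens_piP (s t : seq (U * V)) :
  \pi_tens s = \pi_tens t <-> tens_congr s t.
Proof.
split=> [/eqmodP /asboolP //|st]; by apply/eqmodP/asboolP.
Qed.

Definition formal_scale (a : K) (s : seq (U * V)) :=
  [seq (a *: p.1, p.2) | p <- s].

Definition tens_zero : tens := \pi_tens [::].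
Definition tens_add (x y : tens) : tens := \pi_tens (repr x ++ repr y).
Definition tens_scale (a : K) (x : tens) : tens := \pi_tens (formal_scale a (repr x)).
Definition tens_opp (x : tens) : tens := tens_scale (-1) x.

Lemma repr_congr (s : seq (U * V)) : tens_congr (repr (\pi_tens s)) s.
Proof. by apply/tens_piP; rewrite reprK. Qed.

Lemma formal_scale_congr a s t :
  tens_congr s t -> tens_congr (formal_scale a s) (formal_scale a t).
Proof.
elim=> {s t} [s|s t _|s t r _ + _|s s' t t' _ + _|s t|v|u u' v|u v v'|b u v].
- exact: tens_congr_refl.
- exact: tens_congr_sym.
- exact: tens_congr_trans.
- by rewrite /formal_scale !map_cat; apply: tens_congr_cat.
- by rewrite /formal_scale !map_cat; apply: tens_congr_catC.
- by rewrite /= scaler0; apply: tens_congr_zero.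
- by rewrite /= scalerDr; apply: tens_congr_addl.
- exact: tens_congr_addr.
- by rewrite /= scalerA mulrC -scalerA; apply: tens_congr_scale.
Qed.

Lemma tens_addE (s t : seq (U * V)) :
  tens_add (\pi s) (\pi t) = \pi_tens (s ++ t).
Proof. by apply/tens_piP/tens_congr_cat; apply: repr_congr. Qed.

Lemma tens_scaleE a (s : seq (U * V)) :
  tens_scale a (\pi s) = \pi_tens (formal_scale a s).
Proof. exact/tens_piP/formal_scale_congr/repr_congr. Qed.

Fact tens_addA : associative tens_add.
Proof.
by elim/quotW=> s; elim/quotW=> t; elim/quotW=> r; rewrite !tens_addE catA.
Qed.

Fact tens_addC : commutative tens_add.
Proof.
elim/quotW=> s; elim/quotW=> t; rewrite !tens_addE.
exact/tens_piP/tens_congr_catC.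
Qed.

Fact tens_add0 : left_id tens_zero tens_add.
Proof. by elim/quotW=> s; rewrite tens_addE. Qed.

Fact tens_scaleA a b x :
  tens_scale a (tens_scale b x) = tens_scale (a * b) x.
Proof.
elim/quotW: x => s; rewrite !tens_scaleE /formal_scale -map_comp.
by congr (\pi _); apply: eq_map => p /=; rewrite scalerA.
Qed.

Fact tens_scale1 : left_id 1 tens_scale.
Proof.
elim/quotW=> s; rewrite tens_scaleE; congr (\pi _).
by rewrite /formal_scale -[RHS]map_id; apply: eq_map => -[u v] /=; rewrite scale1r.
Qed.

Fact tens_scaleDr : right_distributive tens_scale tens_add.
Proof.
move=> a; elim/quotW=> s; elim/quotW=> t.
by rewrite tens_addE !tens_scaleE tens_addE /formal_scale map_cat.
Qed.

Lemma tens_pi_cons p (s : seq (U * V)) :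
  \pi_tens (p :: s) = tens_add (\pi [:: p]) (\pi s).
Proof. by rewrite tens_addE. Qed.

Fact tens_scale0 x : tens_scale 0 x = tens_zero.
Proof.
elim/quotW: x => s; rewrite tens_scaleE.
elim: s => [|[u v] s IHs] //=.
rewrite tens_pi_cons IHs scale0r tens_addC tens_add0.
exact/tens_piP/tens_congr_zero.
Qed.

Fact tens_scaleDl a b x :
  tens_scale (a + b) x = tens_add (tens_scale a x) (tens_scale b x).
Proof.
elim/quotW: x => s; rewrite !tens_scaleE.
elim: s => [|[u v] s IHs] /=; first by rewrite tens_add0.
rewrite 3!(tens_pi_cons _ (formal_scale _ _)) IHs.
have -> : \pi_tens [:: ((a + b) *: u, v)] =
    tens_add (\pi [:: (a *: u, v)]) (\pi [:: (b *: u, v)]).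
  by rewrite tens_addE scalerDl; apply/tens_piP/tens_congr_addl.
by rewrite -!tens_addA; congr tens_add; rewrite tens_addA
  [X in tens_add X _]tens_addC -tens_addA.
Qed.

Fact tens_addN : left_inverse tens_zero tens_opp tens_add.
Proof.
move=> x; rewrite -[X in tens_add _ X]tens_scale1 -tens_scaleDl addNr.
exact: tens_scale0.
Qed.

HB.instance Definition _ :=
  GRing.isZmodule.Build tens tens_addA tens_addC tens_add0 tens_addN.

HB.instance Definition _ := GRing.Zmodule_isLmodule.Build K tens
  tens_scaleA tens_scale1 tens_scaleDr (fun x a b => tens_scaleDl a b x).

Definition elem_tens (u : U) (v : V) : tens := \pi_tens [:: (u, v)].

End Tensor.

Notation "u ⊗ v" := (elem_tens u v) (at level 40, left associativity) : ring_scope.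

Section UniversalProperty.
Variables (K : comNzRingType) (U V : lmodType K).

Lemma elem_tens_linearl (v : V) : linear (fun u : U => u ⊗ v).
Proof.
move=> a u u'; rewrite [a *: (u ⊗ v)]tens_scaleE [RHS]tens_addE /=.
exact/tens_piP/tens_congr_addl.
Qed.

Lemma elem_tens_linearr (u : U) : linear (fun v : V => u ⊗ v).
Proof.
move=> a v v'; rewrite [a *: (u ⊗ v)]tens_scaleE [RHS]tens_addE /=.
apply/tens_piP/(tens_congr_trans (tens_congr_addr _ _ _)).
apply: (@tens_congr_cat _ _ _ [:: _] [:: _] [:: _] [:: _]).
  exact/tens_congr_sym/tens_congr_scale.
exact: tens_congr_refl.
Qed.

Lemma tens_piE (s : seq (U * V)) :
  \pi_(tens U V) s = \sum_(p <- s) p.1 ⊗ p.2.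
Proof.
elim: s => [|[u v] s IHs]; first by rewrite big_nil.
by rewrite big_cons -IHs [RHS]tens_addE.
Qed.

Lemma tens_ind (P : tens U V -> Prop) :
  P 0 -> (forall u v z, P z -> P (u ⊗ v + z)) -> forall z, P z.
Proof.
move=> P0 PD; elim/quotW=> s; rewrite tens_piE.
elim: s => [|[u v] s IHs]; first by rewrite big_nil.
by rewrite big_cons; apply: PD.
Qed.

Lemma tens_linear_ext (W : lmodType K) (f g : {linear tens U V -> W}) :
  (forall u v, f (u ⊗ v) = g (u ⊗ v)) -> f =1 g.
Proof.
move=> fg; elim/tens_ind=> [|u v z IHz]; first by rewrite !linear0.
by rewrite !linearD IHz fg.
Qed.

Lemma tens_universal (W : lmodType K) (b : U -> V -> W) :
    (forall v, linear (b^~ v)) -> (forall u, linear (b u)) ->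
  exists f : {linear tens U V -> W}, forall u v, f (u ⊗ v) = b u v.
Proof.
move=> bl br.
pose bL v := HB.pack_for {linear U -> W} (b^~ v) (GRing.isLinear.Build _ _ _ _ _ (bl v)).
pose bR u := HB.pack_for {linear V -> W} (b u) (GRing.isLinear.Build _ _ _ _ _ (br u)).
have bZl a u v : b (a *: u) v = a *: b u v by apply: (linearZ_LR (bL v)).
have bZr a u v : b u (a *: v) = a *: b u v by apply: (linearZ_LR (bR u)).
pose ev (s : seq (U * V)) := \sum_(p <- s) b p.1 p.2.
have ev_congr s t : tens_congr s t -> ev s = ev t.
  rewrite /ev; elim=> {s t} [//|//|s t r _ -> _ -> //|s s' t t' _ ss' _ tt'|s t|v|u u' v|u v v'|a u v].
  - by rewrite !big_cat ss' tt'.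
  - by rewrite !big_cat /= addrC.
  - rewrite big_cons big_nil addr0; apply: (linear0 (bL v)).
  - rewrite !big_cons !big_nil !addr0; apply: (linearD (bL v)).
  - rewrite !big_cons !big_nil !addr0; apply: (linearD (bR u)).
  - rewrite !big_cons !big_nil !addr0 /=.
    by rewrite bZl bZr.
have evE s : ev (repr (\pi_(tens U V) s)) = ev s by apply/ev_congr/repr_congr.
have f_lin : linear (fun z : tens U V => ev (repr z)).
  move=> a; elim/quotW=> s; elim/quotW=> t.
  rewrite [a *: _]tens_scaleE [_ + _]tens_addE !evE /ev big_cat big_map scaler_sumr.
  congr (_ + _); apply: eq_bigr => p _; apply: bZl.
exists (HB.pack_for {linear tens U V -> W} (fun z : tens U V => ev (repr z))
  (GRing.isLinear.Build _ _ _ _ _ f_lin)) => u v /=.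
by rewrite evE /ev big_seq1.
Qed.

End UniversalProperty.

Section Norms.
Variable R : realType.

(* The norm of a [normedModType R[i]] takes its values in [R[i]]. *)
Definition rnorm (E : normedModType R[i]) (x : E) : R := complex.Re `|x|.

Definition is_norm (V : lmodType R[i]) (N : V -> R) : Prop :=
  [/\ forall x, 0 <= N x,
      forall x, N x = 0 -> x = 0,
      forall (a : R[i]) x, N (a *: x) = complex.Re `|a| * N x
    & forall x y, N (x + y) <= N x + N y].

Definition isometrically_isomorphic (V W : lmodType R[i])
    (NV : V -> R) (NW : W -> R) : Prop :=
  [/\ is_norm NV, is_norm NW
    & exists f : {linear V -> W}, bijective f /\ forall x, NW (f x) = NV x].

Definition proj_norm (U V : normedModType R[i]) (z : tens U V) : R :=
  inf [set r | exists2 s : seq (U * V), z = \sum_(p <- s) p.1 ⊗ p.2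
             & r = \sum_(p <- s) rnorm p.1 * rnorm p.2].

(* [ffun_rcons x a] is (x_1, ..., x_k, a). *)
Definition ffun_rcons (T : Type) k (x : {ffun 'I_k -> T}) (a : T) :
    {ffun 'I_k.+1 -> T} :=
  [ffun i => if unlift ord_max i is Some j then x j else a].

Section MultiNorm.
Variable E : normedModType R[i].

(* [N k] is a norm on E^k for k >= 1; the value [N 0] is unconstrained. *)
Record multinorm (N : forall k, {ffun 'I_k -> E} -> R) : Prop := Multinorm {
  multinorm_norm : forall k, (0 < k)%N -> is_norm (N k);
  multinorm1 : forall x : E, N 1%N [ffun=> x] = rnorm x;
  multinormA1 : forall k (s : {perm 'I_k}) (x : {ffun 'I_k -> E}), (2 <= k)%N ->
    N k [ffun i => x (s i)] = N k x;
  multinormA2 : forall k (a : 'I_k -> R[i]) (x : {ffun 'I_k -> E}), (2 <= k)%N ->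
    N k [ffun i => a i *: x i]
      <= (\big[Num.max/0]_(i < k) complex.Re `|a i|) * N k x;
  multinormA3 : forall k (x : {ffun 'I_k.+1 -> E}),
    N k.+2 (ffun_rcons x 0) = N k.+1 x;
  multinormA4 : forall k (x : {ffun 'I_k.+1 -> E}),
    N k.+2 (ffun_rcons x (x ord_max)) = N k.+1 x
}.

Definition max_multinorm k (x : {ffun 'I_k -> E}) : R :=
  sup [set r | exists2 N, multinorm N & r = N k x].

End MultiNorm.
End Norms.

(* Main.v *)
(** A representation of [x = (x_1, ..., x_m)] as a family [(u_j, v_j)] with
  [x_i = sum_j u_j(i) v_j] is the same thing as a representation of
  [sum_i delta_i ⊗ x_i] in the tensor product, so the projective norm becomes
  a norm on each power of [E].  These norms form a multi-norm, because every
  axiom follows from one estimate for the operators [u |-> (a_j u(h j))_j] on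
  the first tensor factor.  Any multi-norm [N] satisfies
  [N (a_1 v, ..., a_m v) <= max |a_i| |v|] by (A2) and (A4), and is therefore
  below this one by the triangle inequality. *)

Require Import Defs.
From HB Require Import structures.
From mathcomp Require Import all_boot all_order all_algebra.
From mathcomp Require Import all_classical all_reals all_analysis.
From mathcomp Require Import perm complex.

Import Order.TTheory GRing.Theory Num.Theory.
Import numFieldNormedType.Exports.
Local Open Scope classical_set_scope.
Local Open Scope ring_scope.
Local Open Scope complex_scope.

Set Implicit Arguments.
Unset Strict Implicit.
Unset Printing Implicit Defensive.

(** * Real-valued norms, and the maximum norm on rows *)

Section RealValuedNorm.
Variable R : realType.
Implicit Types E : normedModType R[i].

Lemma rnormC E (x : E) : (rnorm x)%:C = `|x|.
Proof. by rewrite RRe_real // ger0_real. Qed.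

Lemma ReC_norm (a : R[i]) : (complex.Re `|a|)%:C = `|a|.
Proof. by rewrite RRe_real // ger0_real. Qed.

Lemma Re_norm_ge0 (a : R[i]) : 0 <= complex.Re `|a|.
Proof. rewrite -lecR ReC_norm; exact: normr_ge0. Qed.

Lemma Re_normM (a b : R[i]) :
  complex.Re `|a * b| = complex.Re `|a| * complex.Re `|b|.
Proof. by apply: complexI; rewrite rmorphM /= !ReC_norm normrM. Qed.

Lemma Re_norm0 : complex.Re `|0 : R[i]| = 0.
Proof. by apply: complexI; rewrite ReC_norm normr0. Qed.

Lemma Re_norm1 : complex.Re `|1 : R[i]| = 1.
Proof. by apply: complexI; rewrite ReC_norm normr1. Qed.

Lemma rnorm_ge0 E (x : E) : 0 <= rnorm x.
Proof. rewrite -lecR rnormC; exact: normr_ge0. Qed.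

Lemma rnorm0 E : rnorm (0 : E) = 0.
Proof. by apply: complexI; rewrite rnormC normr0. Qed.

Lemma rnorm_eq0 E (x : E) : rnorm x = 0 -> x = 0.
Proof. by move=> x0; apply/normr0_eq0; rewrite -rnormC x0. Qed.

Lemma rnormZ E (a : R[i]) (x : E) : rnorm (a *: x) = complex.Re `|a| * rnorm x.
Proof. by apply: complexI; rewrite rmorphM /= !rnormC ReC_norm normrZ. Qed.

Lemma ler_rnormD E (x y : E) : rnorm (x + y) <= rnorm x + rnorm y.
Proof. by rewrite -lecR rmorphD /= !rnormC ler_normD. Qed.

Lemma ler_rnorm_sum E (I : Type) (s : seq I) (F : I -> E) :
  rnorm (\sum_(i <- s) F i) <= \sum_(i <- s) rnorm (F i).
Proof.
elim/big_rec2: _ => [|i y x _ xy]; first by rewrite rnorm0.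
by apply: le_trans (ler_rnormD _ _) _; rewrite lerD2l.
Qed.

Lemma rnorm_row_coord k (u : 'rV[R[i]]_k) i : complex.Re `|u 0 i| <= rnorm u.
Proof.
rewrite -lecR ReC_norm rnormC -[`|u|]/(mx_norm u) mx_normE.
by rewrite -[leLHS]nngE num_le; exact: (le_bigmax _ _ (0, i)).
Qed.

Lemma rnorm_row_le k (u : 'rV[R[i]]_k) (c : R) : 0 <= c ->
  (forall i, complex.Re `|u 0 i| <= c) -> rnorm u <= c.
Proof.
move=> c0 uc; rewrite -lecR rnormC -[`|u|]/(mx_norm u).
(* A nonzero maximum norm is attained at some entry; if it vanishes, the bound is [0 <= c]
   itself. *)
have [->|/mx_norm_neq0[[i j] /= ->]] := eqVneq (mx_norm u) 0; first by rewrite lecR.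
by rewrite ord1 -ReC_norm lecR.
Qed.

End RealValuedNorm.

(** * The projective norm carried over to the powers of [E] *)

Section AmplificationNorm.
Variables (R : realType) (E : normedModType R[i]).

Definition amp_fun k (s : seq ('rV[R[i]]_k * E)) : {ffun 'I_k -> E} :=
  [ffun i => \sum_(p <- s) p.1 0 i *: p.2].

Definition amp_cost k (s : seq ('rV[R[i]]_k * E)) : R :=
  \sum_(p <- s) rnorm p.1 * rnorm p.2.

Definition amp_norm k (x : {ffun 'I_k -> E}) : R :=
  inf [set r | exists2 s, x = amp_fun s & r = amp_cost s].

Lemma amp_cost_ge0 k (s : seq ('rV[R[i]]_k * E)) : 0 <= amp_cost s.
Proof. by apply: sumr_ge0 => p _; apply: mulr_ge0; apply: rnorm_ge0. Qed.

(** Makes the set in [amp_norm] nonempty, so that its infimum is a genuine one. *)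
Lemma amp_fun_surj k (x : {ffun 'I_k -> E}) : exists s, x = amp_fun s.
Proof.
exists [seq (delta_mx 0 i, x i) | i <- enum 'I_k].
apply/ffunP => i; rewrite ffunE big_map big_enum /= (bigD1 i) //= mxE !eqxx.
rewrite scale1r big1 ?addr0 // => j ji.
by rewrite mxE eqxx eq_sym (negbTE ji) scale0r.
Qed.

Lemma amp_norm_le k (s : seq ('rV[R[i]]_k * E)) :
  amp_norm (amp_fun s) <= amp_cost s.
Proof.
apply: ge_inf; last by exists s.
by exists 0 => _ [t _ ->]; apply: amp_cost_ge0.
Qed.

Lemma amp_norm_ge k (x : {ffun 'I_k -> E}) b :
  (forall s, x = amp_fun s -> b <= amp_cost s) -> b <= amp_norm x.
Proof.
move=> bs; apply: lb_le_inf; last by move=> _ [s xs ->]; apply: bs.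
by have [s xs] := amp_fun_surj x; exists (amp_cost s), s.
Qed.

Lemma amp_norm_geM k (x : {ffun 'I_k -> E}) b c : 0 <= c ->
  (forall s, x = amp_fun s -> b <= c * amp_cost s) -> b <= c * amp_norm x.
Proof.
rewrite le_eqVlt => /predU1P[<-|c_gt0] bs.
  (* For [c = 0] one cannot divide by [c], but any single representation gives [b <= 0]. *)
  by have [s /bs] := amp_fun_surj x; rewrite !mul0r.
rewrite mulrC -ler_pdivrMr //; apply: amp_norm_ge => s /bs.
by rewrite ler_pdivrMr // mulrC.
Qed.

Lemma amp_norm_ge0 k (x : {ffun 'I_k -> E}) : 0 <= amp_norm x.
Proof. by apply: amp_norm_ge => s _; apply: amp_cost_ge0. Qed.

Lemma ler_amp_normD k (x y : {ffun 'I_k -> E}) :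
  amp_norm (x + y) <= amp_norm x + amp_norm y.
Proof.
(* Moving one summand across at a time lets each infimum be treated alone; concatenating the two
   representations then adds their costs. *)
rewrite -lerBlDr; apply: amp_norm_ge => s xs.
rewrite lerBlDr -lerBlDl; apply: amp_norm_ge => t yt; rewrite lerBlDl.
rewrite /amp_cost -big_cat (_ : x + y = amp_fun (s ++ t)) ?amp_norm_le //.
by apply/ffunP => i; rewrite xs yt !ffunE big_cat.
Qed.

(** Applying the row operator to the first factors turns a representation of [x] into one of the new
    family, and each row norm grows at most by the factor [c]. The map [h] may omit or repeat
    indices, as A3 and A4 require. *)
Lemma amp_norm_reindex k l (h : 'I_l -> 'I_k) (a : 'I_l -> R[i]) (c : R)
    (x : {ffun 'I_k -> E}) : 0 <= c -> (forall j, complex.Re `|a j| <= c) ->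
  amp_norm [ffun j => a j *: x (h j)] <= c * amp_norm x.
Proof.
move=> c0 ac; apply: amp_norm_geM => // s ->.
pose t := [seq (\row_j (a j * p.1 0 (h j)), p.2) | p : 'rV[R[i]]_k * E <- s].
have -> : [ffun j => a j *: amp_fun s (h j)] = amp_fun t.
  apply/ffunP => j; rewrite !ffunE big_map scaler_sumr.
  by apply: eq_bigr => p _; rewrite mxE scalerA.
apply: le_trans (amp_norm_le _) _.
rewrite /amp_cost big_map mulr_sumr; apply: ler_sum => p _ /=.
rewrite mulrA; apply: ler_wpM2r; first exact: rnorm_ge0.
apply: rnorm_row_le => [|j]; first by rewrite mulr_ge0 ?rnorm_ge0.
rewrite mxE Re_normM.
by apply: ler_pM; rewrite ?Re_norm_ge0 ?ac ?rnorm_row_coord.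
Qed.

Lemma amp_norm_reindex1 k l (h : 'I_l -> 'I_k) (x : {ffun 'I_k -> E}) :
  amp_norm [ffun j => x (h j)] <= amp_norm x.
Proof.
rewrite -[leRHS]mul1r.
rewrite (_ : [ffun j => x (h j)] = [ffun j => 1 *: x (h j)]).
  by apply: amp_norm_reindex => // j; rewrite Re_norm1.
by apply/ffunP => j; rewrite !ffunE scale1r.
Qed.

Lemma amp_normZ k (a : R[i]) (x : {ffun 'I_k -> E}) :
  amp_norm (a *: x) = complex.Re `|a| * amp_norm x.
Proof.
have le_normZ b (y : {ffun 'I_k -> E}) :
    amp_norm (b *: y) <= complex.Re `|b| * amp_norm y.
  rewrite (_ : b *: y = [ffun j => b *: y (id j)]).
    by apply: amp_norm_reindex; rewrite ?Re_norm_ge0.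
  by apply/ffunP => j; rewrite !ffunE.
apply: le_anti; rewrite le_normZ andTb.
have [->|a0] := eqVneq a 0; first by rewrite Re_norm0 mul0r amp_norm_ge0.
(* The reverse inequality is the same bound for [a^-1] acting on [a *: x]. *)
rewrite -{1}[x]scale1r -(mulVf a0) -scalerA.
apply: (@le_trans _ _ (complex.Re `|a| * (complex.Re `|a^-1| * amp_norm (a *: x)))).
  by rewrite ler_wpM2l ?Re_norm_ge0.
by rewrite mulrA -Re_normM divff // Re_norm1 mul1r.
Qed.

(** The one-term representation by the row 1 and [x] gives the upper bound; the triangle inequality
    in [E] gives the lower one. *)
Lemma amp_norm1 (x : E) : amp_norm ([ffun=> x] : {ffun 'I_1 -> E}) = rnorm x.
Proof.
apply: le_anti; apply/andP; split.
  have -> : [ffun=> x] = amp_fun [:: (const_mx 1 : 'rV_1, x)].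
    by apply/ffunP => i; rewrite !ffunE big_seq1 mxE scale1r.
  apply: le_trans (amp_norm_le _) _; rewrite /amp_cost big_seq1 /=.
  rewrite -[leRHS]mul1r; apply: ler_wpM2r; first exact: rnorm_ge0.
  by apply: rnorm_row_le => // i; rewrite mxE Re_norm1.
apply: amp_norm_ge => s /ffunP/(_ ord0); rewrite !ffunE => ->.
apply: le_trans (ler_rnorm_sum _ _) _; apply: ler_sum => p _.
by rewrite rnormZ ler_wpM2r ?rnorm_ge0 ?rnorm_row_coord.
Qed.

(** Picking one coordinate is a reindexing along a constant map. This bound makes [amp_norm]
    definite. *)
Lemma rnorm_le_amp_norm k (x : {ffun 'I_k -> E}) i : rnorm (x i) <= amp_norm x.
Proof.
rewrite -amp_norm1 (_ : [ffun=> x i] = [ffun j : 'I_1 => x ((fun=> i) j)]) //.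
exact: amp_norm_reindex1.
Qed.

Lemma amp_norm_is_norm k : is_norm (@amp_norm k).
Proof.
split; [exact: amp_norm_ge0| |exact: amp_normZ|exact: ler_amp_normD].
move=> x x0; apply/ffunP => i; rewrite ffunE; apply: rnorm_eq0.
by apply: le_anti; rewrite rnorm_ge0 andbT -x0 rnorm_le_amp_norm.
Qed.

(** * The multi-norm axioms for [amp_norm] *)

Lemma ffun_rcons_lift (T : Type) k (x : {ffun 'I_k -> T}) a :
  [ffun j => ffun_rcons x a (lift ord_max j)] = x.
Proof. by apply/ffunP => j; rewrite !ffunE liftK. Qed.

Lemma amp_norm_multinorm : multinorm amp_norm.
Proof.
(* Dropping the last entry is a reindexing; this is one half of both A3 and A4. *)
have rcons_ge k (x : {ffun 'I_k -> E}) a : amp_norm x <= amp_norm (ffun_rcons x a).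
  by rewrite -{1}(ffun_rcons_lift x a) amp_norm_reindex1.
split=> [k _|x|k s x _|k a x _|k x|k x].
- exact: amp_norm_is_norm.
- exact: amp_norm1.
- apply: le_anti; rewrite amp_norm_reindex1 /=.
  rewrite -{1}[x](_ : [ffun i => [ffun i => x (s i)] (s^-1%g i)] = x).
    exact: amp_norm_reindex1.
  by apply/ffunP => i; rewrite !ffunE permKV.
- rewrite (_ : [ffun i => a i *: x i] = [ffun i => a i *: x (id i)]) //.
  apply: amp_norm_reindex => [|j]; first exact: bigmax_ge_id.
  exact: (le_bigmax _ (fun i => complex.Re `|a i|)).
- apply: le_anti; rewrite rcons_ge andbT -[leRHS]mul1r.
  (* The weight [a] is 0 exactly at the appended index, so the value [ord_max] that [h] takes there
     is an arbitrary choice. *)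
  pose a (i : 'I_k.+2) : R[i] := (unlift ord_max i != None)%:R.
  pose h (i : 'I_k.+2) := odflt ord_max (unlift ord_max i).
  rewrite (_ : ffun_rcons x 0 = [ffun i => a i *: x (h i)]).
    apply: amp_norm_reindex => // i; rewrite /a.
    by case: (_ != _); rewrite ?Re_norm1 ?Re_norm0.
  apply/ffunP => i; rewrite !ffunE /a /h.
  by case: unlift => [j|] /=; rewrite ?scale1r ?scale0r.
- apply: le_anti; rewrite rcons_ge andbT.
  (* Here the default [ord_max] matters: it is the index of the entry that is repeated. *)
  rewrite (_ : ffun_rcons _ _ =
      [ffun i => x (odflt ord_max (unlift ord_max i))]).
    exact: amp_norm_reindex1.
  by apply/ffunP => i; rewrite !ffunE; case: unlift.
Qed.

(** * Comparison with an arbitrary multi-norm *)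

Lemma multinorm_const (N : forall k, {ffun 'I_k -> E} -> R) k v :
  multinorm N -> (0 < k)%N -> N k [ffun=> v] = rnorm v.
Proof.
move=> mN; case: k => // k _; elim: k => [|k IHk]; first exact: multinorm1.
(* The longer constant family repeats the last entry of the shorter one, so A4 applies. *)
rewrite -IHk -[RHS](multinormA4 mN); congr (N k.+2 _).
by apply/ffunP => i; rewrite !ffunE; case: unlift => // j; rewrite ffunE.
Qed.

Lemma multinorm_row_le (N : forall k, {ffun 'I_k -> E} -> R) k (u : 'rV_k) v :
  multinorm N -> (0 < k)%N -> N k [ffun i => u 0 i *: v] <= rnorm u * rnorm v.
Proof.
move=> mN k_gt0; rewrite -(multinorm_const v mN k_gt0).
have [N_ge0 _ NZ _] := multinorm_norm mN k_gt0.
(* A2 is available only from length 2 on; length 1 uses homogeneity of the norm. *)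
case: k => [|[|k]] // in k_gt0 u N_ge0 NZ *.
  rewrite (_ : [ffun i => u 0 i *: v] = u 0 0 *: [ffun=> v]).
    by rewrite NZ ler_wpM2r ?rnorm_row_coord.
  by apply/ffunP => i; rewrite !ffunE ord1.
rewrite (_ : [ffun i => u 0 i *: v] =
    [ffun i => u 0 i *: ([ffun=> v] : {ffun 'I_k.+2 -> E}) i]).
  apply: le_trans (multinormA2 mN _ _ _) _ => //; apply: ler_wpM2r => //.
  by apply: bigmax_le => [|i _]; rewrite ?rnorm_ge0 ?rnorm_row_coord.
by apply/ffunP => i; rewrite !ffunE.
Qed.

Lemma multinorm_le_amp_norm (N : forall k, {ffun 'I_k -> E} -> R) k x :
  multinorm N -> (0 < k)%N -> N k x <= amp_norm x.
Proof.
move=> mN k_gt0; apply: amp_norm_ge => s ->.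
have [_ _ NZ ND] := multinorm_norm mN k_gt0.
elim: s => [|[u v] s IHs].
  (* Writing the empty sum as a multiple by 0 lets homogeneity give norm 0. *)
  rewrite (_ : amp_fun [::] = 0 *: 0).
    by rewrite NZ Re_norm0 mul0r amp_cost_ge0.
  by apply/ffunP => i; rewrite !ffunE big_nil scale0r.
rewrite (_ : amp_fun _ = [ffun i => u 0 i *: v] + amp_fun s).
  rewrite /amp_cost big_cons; apply: le_trans (ND _ _) (lerD _ IHs).
  exact: multinorm_row_le.
by apply/ffunP => i; rewrite !ffunE big_cons.
Qed.

(** The supremum is attained: [amp_norm] is one of the multi-norms and bounds all the others. *)
Lemma max_multinormE k (x : {ffun 'I_k -> E}) : (0 < k)%N ->
  max_multinorm x = amp_norm x.
Proof.
move=> k_gt0.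
have ub : ubound [set r | exists2 N, multinorm N & r = N k x] (amp_norm x).
  by move=> _ [N mN ->]; apply: multinorm_le_amp_norm.
have mem : [set r | exists2 N, multinorm N & r = N k x] (amp_norm x).
  by exists amp_norm => //; apply: amp_norm_multinorm.
apply: le_anti; apply/andP; split.
  by apply: ge_sup => //; exists (amp_norm x).
by apply: ub_le_sup => //; exists (amp_norm x).
Qed.

End AmplificationNorm.

(** * The linear isomorphism with the tensor product *)

Section RowTensor.
Variables (R : realType) (E : normedModType R[i]) (m : nat).

(* The cast selects the module structure used in [proj_norm]; unifying it with
  the direct one on row vectors takes minutes. *)
Definition row_tens (x : {ffun 'I_m -> E}) :
    tens ('rV[R[i]]_m : normedModType R[i]) E :=
  \sum_i delta_mx 0 i ⊗ x i.

Fact row_tens_linear : linear row_tens.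
Proof.
move=> a x y; rewrite /row_tens scaler_sumr -big_split; apply: eq_bigr => i _.
by rewrite !ffunE elem_tens_linearr.
Qed.

HB.instance Definition _ :=
  GRing.isLinear.Build _ _ _ _ row_tens row_tens_linear.

Lemma row_tens_elem (u : 'rV[R[i]]_m) (v : E) :
  row_tens [ffun i => u 0 i *: v] = u ⊗ v.
Proof.
pose L := HB.pack_for {linear 'rV[R[i]]_m -> tens 'rV[R[i]]_m E}
  (fun w : 'rV[R[i]]_m => w ⊗ v)
  (GRing.isLinear.Build _ _ _ _ _ (elem_tens_linearl v)).
rewrite [in RHS](row_sum_delta u) -[RHS]/(L _) linear_sum.
apply: eq_bigr => i _; rewrite ffunE /=.
exact/esym/tens_piP/tens_congr_scale.
Qed.

(** The inverse comes from the universal property, applied to the bilinear map that multiplies [v]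
    by the entries of [u]. *)
Lemma row_tens_bij : exists2 g : {linear tens 'rV[R[i]]_m E -> {ffun 'I_m -> E}},
  cancel row_tens g /\ cancel g row_tens
  & forall u v, g (u ⊗ v) = [ffun i => u 0 i *: v].
Proof.
have bl (v : E) : linear (fun u : 'rV[R[i]]_m => [ffun i => u 0 i *: v]).
  by move=> a u w; apply/ffunP => i; rewrite !ffunE !mxE scalerDl scalerA.
have br (u : 'rV[R[i]]_m) : linear (fun v : E => [ffun i => u 0 i *: v]).
  move=> a v w; apply/ffunP => i.
  by rewrite !ffunE scalerDr !scalerA mulrC.
have [g gE] := tens_universal bl br.
exists g => //; split=> [x|].
  rewrite linear_sum /=; apply/ffunP => i; rewrite sum_ffunE (bigD1 i) //=.
  rewrite gE ffunE mxE !eqxx scale1r big1 ?addr0 // => j ji.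
  by rewrite gE ffunE mxE eqxx eq_sym (negbTE ji) scale0r.
elim/tens_ind=> [|u v z IHz]; first by rewrite !linear0.
by rewrite !linearD /= IHz gE row_tens_elem.
Qed.

(** Since [row_tens] is injective and sends [amp_fun s] to the tensor represented by [s], both
    infima run over the same set of costs. *)
Lemma proj_norm_row_tens (x : {ffun 'I_m -> E}) :
  proj_norm (row_tens x) = amp_norm x.
Proof.
have [g [xK gK] gE] := row_tens_bij.
have row_tens_amp s : row_tens (amp_fun s) = \sum_(p <- s) p.1 ⊗ p.2.
  apply: (can_inj gK); rewrite xK linear_sum; apply/ffunP => i.
  by rewrite sum_ffunE ffunE; apply: eq_bigr => p _; rewrite gE ffunE.
congr inf; apply/seteqP; split=> _ [s xs ->]; exists s => //.
  by apply: (can_inj xK); rewrite xs row_tens_amp.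
by rewrite xs row_tens_amp.
Qed.

End RowTensor.

Theorem theorem3p43 (R : realType) (E : normedModType R[i]) (m : nat)
    (m_gt0 : (0 < m)%N) :
  isometrically_isomorphic
    (@max_multinorm R E m) (@proj_norm R 'rV[R[i]]_m E).
Proof.
have maxE : @max_multinorm R E m = @amp_norm R E m.
  by apply/funext => x; apply: max_multinormE.
have [g [xK gK] _] := row_tens_bij E m.
(* Through [g] the norm axioms, definiteness included, pass from [amp_norm] to the projective
   norm. *)
have projE z : proj_norm z = amp_norm (g z).
  by rewrite -{1}[z]gK proj_norm_row_tens.
have [N_ge0 N_eq0 NZ ND] := @amp_norm_is_norm R E m.
rewrite maxE; split; first exact: amp_norm_is_norm.
- split=> [z|z|a z|z w]; rewrite !projE ?linearD //.
    by move=> /N_eq0 gz0; rewrite -[z]gK gz0 linear0.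
  by rewrite linearZ; apply: NZ.
- exists (@row_tens R E m : {linear _ -> _}).
  exact: (conj (Bijective xK gK) (@proj_norm_row_tens R E m)).
Qed.
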